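(* Let $M\ge1$ be an integer, $\alpha_{\rm c}>0$, $p>0$, $\mathcal R_0>0$, let $\mathbf h_{\rm s}\in\mathbb C^{M\times1}$ be a fixed nonzero vector, $\mathbf w_{\rm s}=\mathbf h_{\rm s}/\lVert\mathbf h_{\rm s}\rVert$, and let $\mathbf h_{\rm c}\sim\mathcal{CN}(\mathbf 0,\alpha_{\rm c}\mathbf I)$ be a random vector in $\mathbb C^{M\times1}$. The outage probability of the sensing-centric design, $\mathcal P_{\rm c}^{\rm s}=\Pr(\log_2(1+p|\mathbf w_{\rm s}^{\mathsf H}\mathbf h_{\rm c}|^2)<\mathcal R_0)$, is given by $$\mathcal P_{\rm c}^{\rm s}=1-e^{-\frac{2^{\mathcal R_0}-1}{p\alpha_{\rm c}}}.$$ Moreover, as $p\to\infty$, $$\mathcal P_{\rm c}^{\rm s}\approx\frac{2^{\mathcal R_0}-1}{p\alpha_{\rm c}}.$$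
   Context: A base station with $M$ transmit antennas uses power budget $p$ and a unit-norm beamformer $\mathbf w\in\mathbb C^{M\times1}$; a single-antenna user with channel $\mathbf h_{\rm c}$ attains the communication rate $\log_2(1+p|\mathbf w^{\mathsf H}\mathbf h_{\rm c}|^2)$. The sensing-centric design uses $\mathbf w=\mathbf w_{\rm s}$, where $\mathbf h_{\rm s}$ is the (deterministic, nonzero) transmit array steering vector toward the sensed target. $\mathcal R_0$ is the target communication rate. $\mathcal{CN}(\mathbf 0,\alpha_{\rm c}\mathbf I)$ is the circularly symmetric complex Gaussian law: i.i.d. entries with mean zero and variance $\mathbb E|\cdot|^2=\alpha_{\rm c}$. For outage probabilities, ''$\approx$ as $p\to\infty$'' means that the ratio of the two sides tends to $1$. *)

(* Defs.v *)
From HB Require Import structures.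
From mathcomp Require Import all_boot all_order all_algebra.
From mathcomp Require Import all_classical all_reals all_analysis.
From mathcomp Require Import complex spectral.

Set Implicit Arguments.
Unset Strict Implicit.
Unset Printing Implicit Defensive.

Import Order.TTheory GRing.Theory Num.Theory.
Import numFieldNormedType.Exports.

Local Open Scope classical_set_scope.
Local Open Scope ring_scope.
Local Open Scope sesquilinear_scope.

Definition log2 {R : realType} (x : R) : R := ln x / ln 2.

(* The norm the analysis library puts on matrices is the sup norm, hence this
   explicit Euclidean norm; [Normc.normc] is the R-valued modulus of R[i]. *)
Definition l2norm {R : realType} {M : nat} (v : 'cV[R[i]]_M) : R :=
  Num.sqrt (\sum_(i < M) Normc.normc (v i ord0) ^+ 2).

Definition normalize {R : realType} {M : nat} (v : 'cV[R[i]]_M) : 'cV[R[i]]_M :=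
  ((l2norm v)^-1%:C)%C *: v.

Definition hdot {R : realType} {M : nat} (w h : 'cV[R[i]]_M) : R[i] :=
  (w ^t* *m h) ord0 ord0.

Definition rate {R : realType} {M : nat} (p : R) (w h : 'cV[R[i]]_M) : R :=
  log2 (1 + p * Normc.normc (hdot w h) ^+ 2).

(* C is identified with R * R, whose product sigma-algebra is the Borel one. *)
Definition re_im {R : realType} (z : R[i]) : R * R :=
  (complex.Re z, complex.Im z).

(* CN(0, alpha) on C: independent real and imaginary parts, each N(0, alpha/2),
   so that E|z|^2 = alpha.  The second argument of [normal_prob] is the standard
   deviation. *)
Definition complex_normal_prob {R : realType} (alpha : R) :
    set (R * R) -> \bar R :=
  (normal_prob 0 (Num.sqrt (alpha / 2)) \x
   normal_prob 0 (Num.sqrt (alpha / 2)))%E.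

(* Finite subfamilies are covered by taking [A i = setT] outside of them. *)
Definition mutually_independent {d d' : measure_display}
    {T : measurableType d} {T' : measurableType d'} {R : realType}
    (P : probability T R) (I : finType) (X : I -> T -> T') : Prop :=
  forall A : I -> set T', (forall i, measurable (A i)) ->
    P [set t | forall i, A i (X i t)] = (\prod_(i : I) P (X i @^-1` A i))%E.

(* h ~ CN(0, alpha I): a random vector with i.i.d. CN(0, alpha) entries. *)
Definition complex_normal_vector {d : measure_display} {T : measurableType d}
    {R : realType} (P : probability T R) (M : nat) (alpha : R)
    (h : T -> 'cV[R[i]]_M) : Prop :=
  let entry (i : 'I_M) (t : T) := re_im (h t i ord0) in
  [/\ forall i, measurable_fun setT (entry i),
      forall i (B : set (R * R)), measurable B ->
        pushforward P (entry i) B = complex_normal_prob alpha B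
    & mutually_independent P entry].

Definition outage {d : measure_display} {T : measurableType d} {R : realType}
    (P : probability T R) (M : nat) (R0 p : R) (w : 'cV[R[i]]_M)
    (h : T -> 'cV[R[i]]_M) : \bar R :=
  P [set t | rate p w (h t) < R0].

Definition ratio_equiv_pinfty {R : realType} (f g : R -> R) : Prop :=
  (fun p => f p / g p) @ +oo --> (1 : R).

(* Main.v *)
From HB Require Import structures.
Require Import Defs.
From mathcomp Require Import all_boot all_order all_algebra.
From mathcomp Require Import all_classical all_reals all_analysis.
From mathcomp Require Import complex.
From mathcomp Require Import measurable_realfun ring lra.

(** Identify C with R * R.  If Z and Y are independent CN(0, alpha), translating
    z in the double integral and completing the square,
    |u - b y|^2 + |y|^2 = |s y - conj(b) u / s|^2 + |u|^2 / s^2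
    with s^2 = 1 + |b|^2, shows that Z + b Y has the law of s Z.  Adding the
    entries of the channel one at a time, w^H h has the law of c Z for some
    complex c with |c|^2 = \sum_i |w_i|^2 = 1, so |w^H h|^2 has the law of |Z|^2.
    That law is exponential: the area of {r <= |z|^2 < t} is proportional to
    t - r, and writing exp(-|z|^2/alpha) as the integral of the exponential
    density over t > |z|^2 gives Pr(|Z|^2 >= r) = exp(-r/alpha) Pr(|Z|^2 >= 0)
    after translating t by r. *)

Set Implicit Arguments.
Unset Strict Implicit.
Unset Printing Implicit Defensive.
Import Order.TTheory GRing.Theory Num.Theory.
Import numFieldNormedType.Exports.
Local Open Scope classical_set_scope.
Local Open Scope ring_scope.

(** * Measures given by a density *)

Section density.
Local Open Scope ereal_scope.
Context d (T : measurableType d) (R : realType).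
Definition has_density (m mu : set T -> \bar R) (f : T -> R) :=
  [/\ forall x, (0 <= f x)%R, measurable_fun setT f &
      forall A, measurable A -> m A = \int[mu]_(x in A) (f x)%:E].

Variables (mu : {measure set T -> \bar R}) (f : T -> R).
Hypotheses (f0 : forall x, (0 <= f x)%R) (mf : measurable_fun setT f).

(** Integration of the density is packaged as a measure so that uniqueness theorems for measures
    apply to it. *)
Definition density_measure (A : set T) := \int[mu]_(x in A) (f x)%:E.

Let density0 : density_measure set0 = 0.
Proof. exact: integral_set0. Qed.

Let density_ge0 A : 0 <= density_measure A.
Proof. by apply: integral_ge0 => x _; rewrite lee_fin. Qed.

Let density_sigma_additive : semi_sigma_additive density_measure.
Proof.
move=> /= F mF tF mUF; apply: cvg_toP.
  apply: ereal_nondecreasing_is_cvgn => m n mn.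
  exact: lee_sum_nneg_natr.
rewrite /density_measure ge0_integral_bigcup//=.
  exact/measurable_EFinP/measurable_funTS.
by move=> x _; rewrite lee_fin.
Qed.

HB.instance Definition _ := isMeasure.Build _ _ _
  density_measure density0 density_ge0 density_sigma_additive.
Definition measure_of_density : {measure set T -> \bar R} := density_measure.
End density.

(** * Densities of product measures *)

Section product_density.
Local Open Scope ereal_scope.
Context d1 d2 (T1 : measurableType d1) (T2 : measurableType d2) (R : realType).
Variables (m1 mu1 : {sigma_finite_measure set T1 -> \bar R}).
Variables (m2 mu2 : {sigma_finite_measure set T2 -> \bar R}).
Variables (f1 : T1 -> R) (f2 : T2 -> R).

(** Tonelli on a rectangle: once the first coordinate is fixed, [h1] is a constant factor of the
    inner integral. *)
Lemma integral_setX (h1 : T1 -> R) (h2 : T2 -> R) A B :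
  measurable A -> measurable B ->
  (forall x, (0 <= h1 x)%R) -> (forall x, (0 <= h2 x)%R) ->
  measurable_fun setT h1 -> measurable_fun setT h2 ->
  \int[mu1 \x mu2]_(z in A `*` B) (h1 z.1 * h2 z.2)%:E =
  (\int[mu1]_(x in A) (h1 x)%:E) * (\int[mu2]_(x in B) (h2 x)%:E).
Proof.
move=> mA mB h10 h20 mh1 mh2.
have mp1 : measurable_fun setT (fun z : T1 * T2 => h1 z.1).
  exact: (measurableT_comp mh1 measurable_fst).
have mp2 : measurable_fun setT (fun z : T1 * T2 => h2 z.2).
  exact: (measurableT_comp mh2 measurable_snd).
rewrite integral_mkcond fubini_tonelli1; last 2 first.
- apply: (measurable_restrictT _ (measurableX mA mB)).1.
  apply/measurable_EFinP/measurable_funTS.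
  exact: measurable_funM.
- by move=> z; apply: erestrict_ge0 => w _; rewrite lee_fin mulr_ge0.
rewrite [in RHS]integral_mkcond -ge0_integralZr//; last 3 first.
- apply: (measurable_restrictT _ mA).1.
  exact/measurable_EFinP/measurable_funTS.
- by move=> z _; apply: erestrict_ge0 => w _; rewrite lee_fin.
- by apply: integral_ge0 => x _; rewrite lee_fin.
apply: eq_integral => x _; rewrite /fubini_F.
rewrite !patchE; case: ifPn => xA; last first.
  rewrite mul0e; apply: integral0_eq => y _.
  rewrite patchE ifF//; apply/negbTE; rewrite notin_setE => -[/= /mem_set].
  by rewrite (negbTE xA).
rewrite -ge0_integralZl//; last 3 first.
- exact/measurable_EFinP/measurable_funTS.
- by move=> y _; rewrite lee_fin.
- by rewrite lee_fin.
rewrite [RHS]integral_mkcond; apply: eq_integral => y _.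
by rewrite !patchE EFinM in_setX /= xA.
Qed.

(** A product measure is determined by its values on measurable rectangles, where [integral_setX]
    factors the integral. *)
Lemma product_density : has_density m1 mu1 f1 -> has_density m2 mu2 f2 ->
  has_density (m1 \x m2) (mu1 \x mu2) (fun z => f1 z.1 * f2 z.2)%R.
Proof.
move=> [f10 mf1 m1E] [f20 mf2 m2E].
have f0 (z : T1 * T2) : (0 <= f1 z.1 * f2 z.2)%R by rewrite mulr_ge0.
have mf : measurable_fun setT (fun z : T1 * T2 => f1 z.1 * f2 z.2)%R.
  apply: measurable_funM.
    exact: (measurableT_comp mf1 measurable_fst).
  exact: (measurableT_comp mf2 measurable_snd).
split=> // A mA.
transitivity (measure_of_density (mu1 \x mu2) f0 mf A); last by [].
apply: product_measure_unique => // B C mB mC.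
by rewrite m1E// m2E// -integral_setX.
Qed.
End product_density.

(** * Image measures and change of variables up to a factor *)

Definition image_measure d d' (T1 : measurableType d) (T2 : measurableType d')
    (R : realType) (m : {measure set T1 -> \bar R}) (f : T1 -> T2)
    (mf : measurable_fun setT f) : {measure set T2 -> \bar R}.
Proof. by refine (pushforward m f : {measure set T2 -> \bar R}); exact: mf. Defined.

(** [m'] agrees with [k] times the image of [m] under [f], so the pushforward formula applies up to
    a scalar. It serves for affine maps, where [k] is the Jacobian, and for the weighted law in
    [law_partial_sum]. *)
Lemma ge0_integral_scaled_image d d' (T1 : measurableType d)
    (T2 : measurableType d') (R : realType) (m : {measure set T1 -> \bar R})
    (m' : {measure set T2 -> \bar R}) (f : T1 -> T2) (k : R) (h : T2 -> \bar R) :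
  measurable_fun setT f -> 0 <= k ->
  (forall A, measurable A -> m' A = (k%:E * m (f @^-1` A))%E) ->
  (forall x, 0 <= h x)%E -> measurable_fun setT h ->
  (\int[m']_x h x = k%:E * \int[m]_x h (f x))%E.
Proof.
move=> mf k0 m'E h0 mh.
pose s := mscale (NngNum k0) (image_measure m mf).
transitivity (\int[s]_x h x)%E.
  by apply: eq_measure_integral => A mA _; exact: m'E.
by rewrite ge0_integral_mscale//= (ge0_integral_pushforward mf).
Qed.

(** * Lebesgue measure on the plane *)

Section lebesgue_measure2.
Context (R : realType).
Local Notation mu := (@lebesgue_measure R).
Local Notation V := (measurableTypeR R * measurableTypeR R)%type.

(* Sigma-finiteness is not inferred for a product [m1 \x m2] of sigma-finite
   measures, hence a named product carrying that structure. *)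
Definition lebesgue_measure2 : set V -> \bar R := (mu \x mu)%E.

HB.instance Definition _ := Measure.copy lebesgue_measure2 (mu \x mu)%E.

Let lebesgue_measure2_sigma_finite : sigma_finite setT lebesgue_measure2.
Proof.
have /sigma_finiteP[F [TF ndF Foo]] := sigma_finiteT mu.
(* Squares over an increasing exhaustion: monotonicity puts both coordinates of a point in a set of
   common index. *)
exists (fun n => F n `*` F n); last first.
  move=> k; have [mF Fk] := Foo k; split; first exact: measurableX.
  rewrite [ltLHS]product_measure1E//; apply: lte_mul_pinfty => //.
  by rewrite ge0_fin_numE.
rewrite -setXTT TF predeqE => -[x y]; split=> [[/= [n _ Fnx] [k _ Fky]]|].
  exists (maxn n k) => //; split.
    by move: x Fnx; exact/subsetPset/ndF/leq_maxl.
  by move: y Fky; exact/subsetPset/ndF/leq_maxr.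
by move=> [n _ []/= ? ?]; split; exists n.
Qed.

HB.instance Definition _ := Measure_isSigmaFinite.Build _ _ _
  lebesgue_measure2 lebesgue_measure2_sigma_finite.

End lebesgue_measure2.

(** * Affine changes of variables on the line and in the plane *)

Section affine.
Local Open Scope ereal_scope.
Context (R : realType).
Local Notation mu := (@lebesgue_measure R).
Local Notation mu2 := (@lebesgue_measure2 R).

Lemma measurable_affine (k c : R) : measurable_fun [set: measurableTypeR R]
  (fun x => k * x + c : measurableTypeR R)%R.
Proof. exact: measurable_funD. Qed.

Lemma preimage_affine_itv (k c a b : R) : (0 < k)%R ->
  (fun x => k * x + c)%R @^-1` `]a, b]%classic =
  `]((a - c) / k)%R, ((b - c) / k)%R]%classic.
Proof.
move=> k0; apply/seteqP; split=> x /=; rewrite !in_itv/=;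
  by rewrite ltr_pdivrMr// ler_pdivlMr// ltrBlDr lerBrDr mulrC.
Qed.

(** By uniqueness of Lebesgue measure, half-open intervals suffice, and the preimage of an interval
    has its length divided by [k]. *)
Lemma lebesgue_measure_affine (k c : R) (A : set (measurableTypeR R)) :
  (0 < k)%R -> measurable A ->
  mu A = k%:E * mu ((fun x => k * x + c)%R @^-1` A).
Proof.
move=> k0 mA; have kge : (0 <= k)%R by exact: ltW.
transitivity (mscale (NngNum kge) (image_measure mu (measurable_affine k c)) A);
  last reflexivity.
apply: lebesgue_measure_unique => //.
move=> _ [[a b] _ <-] /=; rewrite /mscale/= /pushforward preimage_affine_itv//.
rewrite !lebesgue_measure_itv/= !lte_fin ltr_pM2r ?invr_gt0// ltrD2r.
case: ifPn => _; last by rewrite mule0.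
by rewrite -!EFinD -EFinM; congr EFin; field; rewrite gt_eqF.
Qed.

Definition affine2 (k : R) (c z : measurableTypeR R * measurableTypeR R) :
  measurableTypeR R * measurableTypeR R := (k * z.1 + c.1, k * z.2 + c.2)%R.

Lemma measurable_affine2 k c : measurable_fun setT (affine2 k c).
Proof.
apply: measurable_fun_pair.
  exact: (measurableT_comp (measurable_affine k c.1) measurable_fst).
exact: (measurableT_comp (measurable_affine k c.2) measurable_snd).
Qed.

(** Each side of a rectangle contributes one factor [k]; uniqueness of the product measure extends
    this to all measurable sets. *)
Lemma lebesgue_measure2_affine (k : R) c A :
  (0 < k)%R -> measurable A ->
  mu2 A = (k ^+ 2)%:E * mu2 (affine2 k c @^-1` A).
Proof.
move=> k0 mA.
have kge : (0 <= k ^+ 2)%R by exact: sqr_ge0.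
transitivity
  (mscale (NngNum kge) (image_measure mu2 (measurable_affine2 k c)) A);
  last reflexivity.
apply: product_measure_unique => // B C mB mC.
rewrite /= /mscale /= /pushforward.
rewrite (_ : affine2 k c @^-1` _ = ((fun x => k * x + c.1)%R @^-1` B) `*`
   ((fun x => k * x + c.2)%R @^-1` C)); last reflexivity.
rewrite [X in _ * X = _]product_measure1E; last 2 first.
- by rewrite -[X in measurable X]setTI; exact: measurable_affine.
- by rewrite -[X in measurable X]setTI; exact: measurable_affine.
rewrite (lebesgue_measure_affine c.1 k0 mB) (lebesgue_measure_affine c.2 k0 mC).
by rewrite expr2 EFinM muleACA.
Qed.

Lemma integral_affine (k c : R) (f : measurableTypeR R -> \bar R) : (0 < k)%R ->
  (forall x, 0 <= f x) -> measurable_fun setT f ->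
  \int[mu]_x f x = k%:E * \int[mu]_x f (k * x + c)%R.
Proof.
move=> k0 f0 mf; apply: (ge0_integral_scaled_image (measurable_affine k c)) => //.
  exact: ltW.
by move=> A mA; exact: lebesgue_measure_affine.
Qed.

Lemma integral_affine2 (k : R) c (f : _ -> \bar R) : (0 < k)%R ->
  (forall x, 0 <= f x) -> measurable_fun setT f ->
  \int[mu2]_x f x = (k ^+ 2)%:E * \int[mu2]_x f (affine2 k c x).
Proof.
move=> k0 f0 mf; apply: (ge0_integral_scaled_image (measurable_affine2 k c)).
- exact: sqr_ge0.
- by move=> A mA; exact: lebesgue_measure2_affine.
- exact: f0.
- exact: mf.
Qed.
End affine.

(** * Complex arithmetic on pairs of reals *)

Section squared_modulus.
Context (R : realType).
Local Notation V := (measurableTypeR R * measurableTypeR R)%type.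

Definition sqmod (z : V) : R := z.1 ^+ 2 + z.2 ^+ 2.
Definition cmul (b z : V) : V := (b.1 * z.1 - b.2 * z.2, b.1 * z.2 + b.2 * z.1).

Lemma sqmod_ge0 z : 0 <= sqmod z. Proof. by rewrite addr_ge0 ?sqr_ge0. Qed.

Lemma sqmod_eq0 z : (sqmod z == 0) = (z == (0, 0)).
Proof. by rewrite paddr_eq0 ?sqr_ge0// !sqrf_eq0; case: z. Qed.

Lemma sqmodM b z : sqmod (cmul b z) = sqmod b * sqmod z.
Proof. by rewrite /sqmod/cmul/=; ring. Qed.

Lemma measurable_sqmod : measurable_fun setT sqmod.
Proof.
apply: measurable_funD; apply: measurable_funX.
  exact: measurable_fst.
exact: measurable_snd.
Qed.

Lemma measurable_cmul b : measurable_fun setT (cmul b).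
Proof.
apply: measurable_fun_pair.
  by apply: measurable_funB; apply: measurable_funM.
by apply: measurable_funD; apply: measurable_funM.
Qed.

Lemma measurable_cmul_add d (T : measurableType d) (c b : V) (f g : T -> V) :
  measurable_fun setT f -> measurable_fun setT g ->
  measurable_fun setT (fun t => cmul c (f t) + cmul b (g t) : V).
Proof.
move=> mf mg.
have mcf := measurableT_comp (measurable_cmul c) mf.
have mbg := measurableT_comp (measurable_cmul b) mg.
apply: measurable_fun_pair; apply: measurable_funD.
- exact: (measurableT_comp measurable_fst mcf).
- exact: (measurableT_comp measurable_fst mbg).
- exact: (measurableT_comp measurable_snd mcf).
- exact: (measurableT_comp measurable_snd mbg).
Qed.

End squared_modulus.

(** * The complex normal law and its density *)

Section complex_normal_probability.
Context (R : realType) (alpha : R).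
Local Notation V := (measurableTypeR R * measurableTypeR R)%type.

(* [complex_normal_prob] with the probability structure that its defining
   product does not carry. *)
Definition complex_normal : set V -> \bar R := complex_normal_prob alpha.

HB.instance Definition _ := Measure.copy complex_normal
  (normal_prob 0 (Num.sqrt (alpha / 2)) \x normal_prob 0 (Num.sqrt (alpha / 2)))%E.

Let complex_normal_setT : complex_normal setT = 1%E.
Proof.
rewrite -setXTT.
transitivity (normal_prob 0 (Num.sqrt (alpha / 2)) setT *
    normal_prob 0 (Num.sqrt (alpha / 2)) setT)%E.
  exact: product_measure1E.
by rewrite !probability_setT mule1.
Qed.

HB.instance Definition _ := Measure_isProbability.Build _ _ _
  complex_normal complex_normal_setT.
End complex_normal_probability.

Section complex_normal_density.
Context (R : realType).
Local Notation mu := (@lebesgue_measure R).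
Local Notation mu2 := (@lebesgue_measure2 R).
Local Notation V := (measurableTypeR R * measurableTypeR R)%type.
Variable alpha : R.
Hypothesis alpha0 : 0 < alpha.
Let sigma := Num.sqrt (alpha / 2).

Let sigma_neq0 : sigma != 0.
Proof. by rewrite gt_eqF// sqrtr_gt0 divr_gt0. Qed.

(** The density exp(-|z|^2/alpha)/(pi alpha). The constant stays in terms of [normal_peak]: later
    normalisations come from total mass one. *)
Definition cn_pdf (z : V) : R :=
  normal_peak sigma ^+ 2 * expR (- sqmod z / alpha).

Lemma complex_normal_density : has_density (complex_normal alpha) mu2 cn_pdf.
Proof.
have nd : has_density (normal_prob 0 sigma) mu (normal_pdf 0 sigma).
  by split => //; [exact: normal_pdf_ge0 | exact: measurable_normal_pdf].
rewrite (_ : cn_pdf =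
    (fun z => normal_pdf 0 sigma z.1 * normal_pdf 0 sigma z.2)).
  exact: (product_density nd nd).
apply/funext => z; rewrite !normal_pdfE// /cn_pdf/sqmod /normal_fun !subr0.
rewrite mulrACA -expr2; congr (_ * _); rewrite -expRD; congr expR.
(* With variance [alpha / 2] per coordinate, the denominator of the real Gaussian exponent is
   exactly [alpha]. *)
have -> : sigma ^+ 2 *+ 2 = alpha.
  by rewrite sqr_sqrtr ?divr_ge0 ?ltW// -mulr_natr divfK.
by ring.
Qed.

End complex_normal_density.

(** * Completing the square *)

Section complete_square.
Context (R : realType).
Local Notation V := (measurableTypeR R * measurableTypeR R)%type.

Lemma measurable_affine2_comp d (T : measurableType d) (k : R) (f h : T -> V) :
  measurable_fun setT f -> measurable_fun setT h ->
  measurable_fun setT (fun t => affine2 k (f t) (h t)).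
Proof.
move=> mf mh.
have f1 := measurableT_comp measurable_fst mf.
have f2 := measurableT_comp measurable_snd mf.
have h1 := measurableT_comp measurable_fst mh.
have h2 := measurableT_comp measurable_snd mh.
by apply: measurable_fun_pair; apply: measurable_funD => //;
  apply: measurable_funM.
Qed.

Definition cconj (b : V) : V := (b.1, - b.2).

Lemma sqmod_complete_square (b y u : V) (s : R) :
  s ^+ 2 = 1 + sqmod b -> s != 0 ->
  sqmod (affine2 1 (cmul (- b) y) u) + sqmod y =
  sqmod (affine2 s (cmul (affine2 (- s^-1) 0 (cconj b)) u) y) +
  sqmod (affine2 s^-1 0 u).
Proof.
move=> sE s0; apply/subr0_eq.
(* The cross terms cancel, and the two sides differ by a multiple of [1 + sqmod b - s ^+ 2]. *)
transitivity ((1 + sqmod b - s ^+ 2) * (sqmod y - sqmod u / s ^+ 2)); last first.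
  by rewrite sE subrr mul0r.
by rewrite /sqmod/affine2/cmul/cconj/=; field.
Qed.

End complete_square.

(** * The law of Z + b Y *)

Section convolution.
Context (R : realType) (alpha : R).
Hypothesis alpha0 : 0 < alpha.
Local Notation mu := (@lebesgue_measure R).
Local Notation mu2 := (@lebesgue_measure2 R).
Local Notation V := (measurableTypeR R * measurableTypeR R)%type.
Local Notation cn := (complex_normal alpha).
Local Notation g := (cn_pdf alpha).

Let g_ge0 z : 0 <= g z.
Proof. by have [] := complex_normal_density alpha0. Qed.

Let measurable_g : measurable_fun setT g.
Proof. by have [] := complex_normal_density alpha0. Qed.

Lemma integral_cn_pdf : (\int[mu2]_z (g z)%:E = 1)%E.
Proof.
have [_ _ <-//] := complex_normal_density alpha0.
exact: (@probability_setT _ _ _ cn).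
Qed.

Variables (b : V) (B : set V).
Hypothesis mB : measurable B.
Let s := Num.sqrt (1 + sqmod b).
Let sE : s ^+ 2 = 1 + sqmod b.
Proof. by rewrite sqr_sqrtr// addr_ge0// sqmod_ge0. Qed.
Let s0 : 0 < s.
Proof. by rewrite sqrtr_gt0 ltr_pwDl// sqmod_ge0. Qed.

Let c u : V := cmul (affine2 (- s^-1) 0 (cconj b)) u.

Let cn_pdf_square u y : g (affine2 1 (cmul (- b) y) u) * g y =
  g (affine2 s (c u) y) * g (affine2 s^-1 0 u).
Proof.
have gM z w : g z * g w = normal_peak (Num.sqrt (alpha / 2)) ^+ 4 *
    expR (- (sqmod z + sqmod w) / alpha).
  by rewrite /cn_pdf mulrACA -expRD -mulrDl -opprD -exprD.
by rewrite !gM (sqmod_complete_square _ _ sE)// gt_eqF.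
Qed.

(** [F] is the joint density cut to the event that z + b y lies in [B]; [G] is the same integrand in
    the variables u = z + b y and y. *)
Let F (zy : V * V) : R :=
  \1_B (affine2 1 (cmul b zy.2) zy.1) * (g zy.1 * g zy.2).
Let G (uy : V * V) : R :=
  \1_B uy.1 * (g (affine2 1 (cmul (- b) uy.2) uy.1) * g uy.2).

Let measurable_1B : measurable_fun setT (\1_B : V -> R).
Proof. exact: measurable_indic. Qed.

Let measurable_shift e :
  measurable_fun setT (fun zy : V * V => affine2 1 (cmul e zy.2) zy.1).
Proof.
apply: measurable_affine2_comp; last exact: measurable_fst.
exact: (measurableT_comp (measurable_cmul e) measurable_snd).
Qed.

Let mF : measurable_fun setT F.
Proof.
apply: measurable_funM.
  exact: (measurableT_comp measurable_1B (measurable_shift b)).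
apply: measurable_funM.
  exact: (measurableT_comp measurable_g measurable_fst).
exact: (measurableT_comp measurable_g measurable_snd).
Qed.

Let mG : measurable_fun setT G.
Proof.
apply: measurable_funM.
  exact: (measurableT_comp measurable_1B measurable_fst).
apply: measurable_funM.
  exact: (measurableT_comp measurable_g (measurable_shift (- b))).
exact: (measurableT_comp measurable_g measurable_snd).
Qed.

Let F0 z : (0 <= (F z)%:E)%E.
Proof. by rewrite lee_fin /F /G; do 2 apply: mulr_ge0 => //. Qed.

Let G0 z : (0 <= (G z)%:E)%E.
Proof. by rewrite lee_fin /F /G; do 2 apply: mulr_ge0 => //. Qed.

Let intF y : (\int[mu2]_z (F (z, y))%:E = \int[mu2]_u (G (u, y))%:E)%E.
Proof.
rewrite (integral_affine2 (cmul b y) (ltr01 : 0 < 1 :> R)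
  (f := fun u => (G (u, y))%:E)).
- rewrite expr1n mul1e; apply: eq_integral => z _; congr EFin.
  rewrite /F /G /=; congr (_ * (g _ * _)).
  by case: z => z1 z2; rewrite /affine2/cmul/=; congr pair; ring.
- by move=> u; exact: G0.
- by apply/measurable_EFinP; exact: (measurableT_comp mG (measurable_pair2 _)).
Qed.

(** The density has mass one, and y -> s y + v divides it by the Jacobian s^2, whatever the centre
    [v]. *)
Let int_g (v : V) : (\int[mu2]_y (g (affine2 s v y))%:E = (s ^- 2)%:E)%E.
Proof.
have := integral_affine2 v s0 (f := fun z => (g z)%:E).
rewrite integral_cn_pdf => gE.
rewrite -[LHS]mul1e -(mulVf (_ : s ^+ 2 != 0)) ?expf_neq0 ?gt_eqF// EFinM -muleA.
rewrite -gE ?mule1//.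
exact/measurable_EFinP.
Qed.

Let measurable_g_affine (v : V) :
  measurable_fun setT (fun y => g (affine2 s v y)).
Proof. exact: (measurableT_comp measurable_g (measurable_affine2 s v)). Qed.

(** After completing the square, y occurs only in a factor of known mass. *)
Let intG u : (\int[mu2]_y (G (u, y))%:E =
  (s ^- 2)%:E * (\1_B u * g (affine2 s^-1 0 u))%:E)%E.
Proof.
under eq_integral do rewrite /G/= cn_pdf_square mulrCA EFinM.
rewrite ge0_integralZr//.
- by rewrite int_g.
- exact/measurable_EFinP.
- by move=> y _; rewrite lee_fin.
- by rewrite lee_fin mulr_ge0.
Qed.

(** Integrating over z first allows the translation by b y; exchanging the integrals then allows y
    to be integrated out. *)
Lemma complex_normal_conv :
  (cn \x cn)%E [set zy | B (affine2 1 (cmul b zy.2) zy.1)] =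
  cn [set z | B (affine2 s 0 z)].
Proof.
have cnd := complex_normal_density alpha0.
have [_ _ cn2E] :
    has_density (cn \x cn)%E (mu2 \x mu2)%E (fun z => g z.1 * g z.2).
  exact: (product_density (m1 := cn) (m2 := cn) (mu1 := mu2) (mu2 := mu2)).
rewrite cn2E; last first.
  rewrite -[X in measurable X]setTI.
  exact: (measurable_shift b measurableT mB).
have [_ _ ->] := cnd; last first.
  rewrite -[X in measurable X]setTI.
  exact: (measurable_affine2 s 0 measurableT mB).
transitivity (\int[(mu2 \x mu2)%E]_z (F z)%:E)%E.
  rewrite integral_mkcond; apply: eq_integral => z _.
  rewrite patchE /F indicE.
  rewrite (_ : (z \in _) = (affine2 1 (cmul b z.2) z.1 \in B)); last first.
    by apply/idP/idP; rewrite !inE.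
  by case: ifPn => _; rewrite ?mul1r ?mul0r.
rewrite (fubini_tonelli2 (fun z => (F z)%:E))//; last exact/measurable_EFinP.
rewrite /fubini_G; under eq_integral do rewrite intF.
rewrite -(fubini_tonelli (fun z => (G z)%:E))//; last exact/measurable_EFinP.
under eq_integral do rewrite intG.
pose H u := \1_B u * g (affine2 s^-1 0 u).
have H0 u : (0 <= (H u)%:E)%E by rewrite lee_fin mulr_ge0.
have mH : measurable_fun setT (EFin \o H).
  apply/measurable_EFinP/measurable_funM; first exact: measurable_1B.
  exact: (measurableT_comp measurable_g (measurable_affine2 s^-1 0)).
rewrite (@ge0_integralZl_EFin _ _ _ _ _ measurableT (EFin \o H))//; last 2 first.
- by move=> u _; exact: H0.
- by rewrite invr_ge0 sqr_ge0.
(* The substitution u = s z produces s^2, which cancels the s^-2 left by the integral over y. *)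
rewrite [X in (_ * X)%E](_ : _ =
    ((s ^+ 2)%:E * \int[mu2]_u (H (affine2 s 0 u))%:E)%E); last first.
  exact: (integral_affine2 0 s0 H0 mH).
rewrite muleA -EFinM mulVf ?mul1e ?expf_neq0 ?gt_eqF//.
rewrite [RHS]integral_mkcond; apply: eq_integral => z _.
rewrite patchE /= /H indicE.
rewrite (_ : (z \in _) = (affine2 s 0 z \in B)); last first.
  by apply/idP/idP; rewrite !inE.
have -> : affine2 s^-1 0 (affine2 s 0 z) = z.
  by case: z => z1 z2; rewrite /affine2/= !addr0 !mulKf ?gt_eqF.
by case: ifPn => _; rewrite ?mul1r ?mul0r.
Qed.
End convolution.

(** * Areas of discs and annuli *)

Section disc.
Context (R : realType).
Local Notation mu := (@lebesgue_measure R).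
Local Notation mu2 := (@lebesgue_measure2 R).
Local Notation V := (measurableTypeR R * measurableTypeR R)%type.

Lemma measurable_disc (t : R) : measurable [set z : V | sqmod z < t].
Proof.
rewrite (_ : [set z | _] = (@sqmod R) @^-1` `]-oo, t[); last first.
  by apply/seteqP; split=> z /=; rewrite in_itv.
by rewrite -[X in measurable X]setTI; exact: measurable_sqmod.
Qed.

Lemma measurable_disc_ge (r : R) : measurable [set z : V | r <= sqmod z].
Proof.
rewrite (_ : [set z : V | _] = ~` [set z : V | sqmod z < r]).
  by apply: measurableC; exact: measurable_disc.
by apply/seteqP; split=> z /=; rewrite leNgt => /negP.
Qed.

(** This is pi, kept as an abstract constant that the normalisation of the tail absorbs. *)
Definition disc_area : R := fine (mu2 [set z : V | sqmod z < 1]).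

Lemma disc_area_fin : mu2 [set z : V | sqmod z < 1] = disc_area%:E.
Proof.
rewrite /disc_area fineK// ge0_fin_numE//.
(* The unit disc lies in the square of side 2 centred at the origin. *)
apply: (@le_lt_trans _ _ (mu2 (`[-1, 1]%classic `*` `[-1, 1]%classic))).
  apply: le_measure; rewrite ?inE.
  - exact: measurable_disc.
  - by apply: measurableX; exact: measurable_itv.
  - move=> [x y] /=; rewrite /sqmod/= !in_itv/= => xy1.
    by split; apply/andP; split; nra.
rewrite [ltLHS]product_measure1E; [|exact: measurable_itv|exact: measurable_itv].
have itv_fin : (mu `[(-1)%R, 1%R]%classic < +oo)%E.
  by rewrite lebesgue_measure_itv/=; case: ifP => _; rewrite -?EFinB ltry.
by apply: lte_mul_pinfty => //; rewrite ge0_fin_numE.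
Qed.

Lemma lebesgue_measure2_disc (t : R) : 0 <= t ->
  mu2 [set z : V | sqmod z < t] = (disc_area * t)%:E.
Proof.
(* A homothety needs a positive ratio, so the empty disc [t = 0] is treated apart; otherwise the
   ratio is the square root of [t]. *)
rewrite le_eqVlt => /predU1P[<-|t0].
  rewrite (_ : [set _ | _] = set0) ?measure0 ?mulr0//.
  by apply/seteqP; split=> z //=; rewrite ltNge sqmod_ge0.
have st0 : 0 < Num.sqrt t by rewrite sqrtr_gt0.
rewrite (lebesgue_measure2_affine 0 st0 (measurable_disc t)) sqr_sqrtr ?ltW//.
rewrite mulrC EFinM -disc_area_fin; congr (_ * mu2 _)%E.
apply/seteqP; split=> -[x y] /=; rewrite /sqmod/affine2/= !addr0 !exprMn;
  by rewrite sqr_sqrtr ?ltW// -mulrDr gtr_pMr.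
Qed.

Lemma measurable_annulus (r t : R) : measurable [set z : V | r <= sqmod z < t].
Proof.
rewrite (_ : [set z : V | _] = (@sqmod R) @^-1` `[r, t[); last first.
  by apply/seteqP; split=> z /=; rewrite in_itv.
by rewrite -[X in measurable X]setTI; exact: measurable_sqmod.
Qed.

Lemma disc_area_ge0 : 0 <= disc_area. Proof. exact: fine_ge0. Qed.

Lemma lebesgue_measure2_annulus (r t : R) : 0 <= r ->
  mu2 [set z : V | r <= sqmod z < t] = (disc_area * Num.max 0 (t - r))%:E.
Proof.
move=> r0; have [tr|rt] := leP t r.
  rewrite (_ : [set _ | _] = set0) ?measure0 ?max_l ?mulr0 ?subr_le0//.
  apply/seteqP; split=> z //= /andP[rz zt].
  by have := lt_le_trans (le_lt_trans rz zt) tr; rewrite ltxx.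
have t0 : 0 <= t by rewrite (le_trans r0) ?ltW.
rewrite (_ : [set _ | _] =
    [set z : V | sqmod z < t] `\` [set z : V | sqmod z < r]); last first.
  apply/seteqP; split=> z /=.
    by move=> /andP[rz ->]; split => //; rewrite ltNge rz.
  by move=> [-> /negP]; rewrite -leNgt => ->.
rewrite measureD; [|exact: measurable_disc|exact: measurable_disc|]; last first.
  by apply: le_lt_trans (ltry (disc_area * t)); rewrite -lebesgue_measure2_disc.
rewrite (_ : _ `&` _ = [set z : V | sqmod z < r]); last first.
  by apply/setIidr => z /= zr; exact: lt_trans rt.
rewrite [X in (X - _)%E]lebesgue_measure2_disc//.
rewrite [X in (_ - X)%E]lebesgue_measure2_disc//.
by rewrite -EFinB -mulrBr max_r// subr_ge0 ltW.
Qed.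
End disc.

(** * The exponential tail of |Z|^2 *)

Section tail.
Context (R : realType) (alpha : R).
Hypothesis alpha0 : 0 < alpha.
Local Notation mu := (@lebesgue_measure R).
Local Notation mu2 := (@lebesgue_measure2 R).
Local Notation V := (measurableTypeR R * measurableTypeR R)%type.
Local Notation cn := (complex_normal alpha).
Local Notation e := (exponential_pdf alpha^-1).

Let alphaV0 : 0 < alpha^-1. Proof. by rewrite invr_gt0. Qed.
Let e0 t : 0 <= e t. Proof. by apply: exponential_pdf_ge0; exact: ltW. Qed.
Let me : measurable_fun setT e. Proof. exact: measurable_exponential_pdf. Qed.

(** Memorylessness of the exponential density, on the half-line where it is nonzero. *)
Let eD (q s : R) : 0 <= q -> 0 <= s -> e (s + q) = expR (- q / alpha) * e s.
Proof.
move=> q0 s0; rewrite !exponential_pdfE ?addr_ge0// mulrCA -expRD.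
by congr (_ * expR _); ring.
Qed.

Let measurable_1e (r : R) : measurable_fun setT
  (fun t : measurableTypeR R => \1_`]r, +oo[%classic t * e t : R).
Proof.
by apply: measurable_funM => //; apply: measurable_indic; exact: measurable_itv.
Qed.

Lemma integral_exponential_pdf_gt (q : R) : 0 <= q ->
  (\int[mu]_t (\1_`]q, +oo[%classic t * e t)%:E = (expR (- q / alpha))%:E)%E.
Proof.
move=> q0.
rewrite (integral_affine q (ltr01 : 0 < 1 :> R)
  (f := fun t => (\1_`]q, +oo[%classic t * e t)%:E)) ?mul1e; last 2 first.
- by move=> x; rewrite lee_fin mulr_ge0.
- exact/measurable_EFinP.
transitivity (\int[mu]_t ((expR (- q / alpha))%:E *
    (\1_`]0, +oo[%classic t * e t)%:E))%E.
  apply: eq_integral => t _; rewrite mul1r -EFinM; congr EFin.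
  rewrite !indicE !mem_setE !in_itv/= !andbT ltrDr.
  case: ltP => t0; last by rewrite !mul0r mulr0.
  by rewrite !mul1r eD// ltW.
rewrite ge0_integralZl_EFin ?expR_ge0//; last 2 first.
- by move=> x _; rewrite lee_fin mulr_ge0.
- exact/measurable_EFinP.
rewrite [X in (_ * X)%E](_ : _ = 1%E) ?mule1//.
rewrite -(integral_exponential_pdf alphaV0).
transitivity (\int[mu]_(t in `]0%R, +oo[%classic) (e t)%:E)%E.
  rewrite [RHS]integral_mkcond; apply: eq_integral => t _.
  by rewrite patchE indicE; case: ifP => _; rewrite ?mul1r ?mul0r.
(* The endpoint 0 has measure zero and the density vanishes on negative reals, so the integral is
   the total mass. *)
rewrite integral_itv_obnd_cbnd; last exact/measurable_EFinP/measurable_funTS.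
rewrite [LHS]integral_mkcond; apply: eq_integral => t _.
rewrite patchE mem_setE in_itv/= andbT; case: leP => // t0.
by rewrite lt0_exponential_pdf.
Qed.

Let C := normal_peak (Num.sqrt (alpha / 2)) ^+ 2.
Let C0 : 0 <= C. Proof. exact: sqr_ge0. Qed.

(** The contribution of level [t]: exponential weight times the area of the annulus r <= |z|^2 <
    t. *)
Let psi (r t : R) : R := C * e t * (disc_area R * Num.max 0 (t - r)).

Let tail_psi r : 0 <= r ->
  cn [set z | r <= sqmod z] = (\int[mu]_t (psi r t)%:E)%E.
Proof.
move=> r0.
have [_ _ ->] := complex_normal_density alpha0; last exact: measurable_disc_ge.
(* [S] is the region of the double integral in z and the level t; its section at fixed t is the
   annulus. *)
pose S := [set zt : V * measurableTypeR R | r <= sqmod zt.1 < zt.2].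
have mS2 : measurable S.
  rewrite (_ : S = setT `&` (fun zt : V * measurableTypeR R =>
      r <= sqmod zt.1 < zt.2) @^-1` [set true]).
    apply: measurable_and => //.
      apply: measurable_fun_ler => //.
      exact: (measurableT_comp (@measurable_sqmod R) measurable_fst).
    apply: measurable_fun_ltr => //.
      exact: (measurableT_comp (@measurable_sqmod R) measurable_fst).
  by rewrite setTI; apply/seteqP; split.
pose Phi (zt : V * measurableTypeR R) : R := \1_S zt * (C * e zt.2).
have Phi0 zt : (0 <= (Phi zt)%:E)%E by rewrite lee_fin /Phi; do 2 apply: mulr_ge0 => //.
have mPhi : measurable_fun setT (EFin \o Phi).
  apply/measurable_EFinP/measurable_funM; first exact: measurable_indic.
  apply: measurable_funM => //.
  exact: (measurableT_comp me measurable_snd).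
transitivity (\int[mu2]_z \int[mu]_t (Phi (z, t))%:E)%E.
  rewrite integral_mkcond; apply: eq_integral => z _.
  transitivity (\int[mu]_t ((C * \1_[set z : V | r <= sqmod z] z)%:E *
      (\1_`]sqmod z, +oo[%classic t * e t)%:E))%E; last first.
    apply: eq_integral => t _; rewrite /Phi -EFinM; congr EFin.
    rewrite !indicE.
    rewrite (_ : (_ \in S) = (r <= sqmod z) && (sqmod z < t)); last first.
      by apply/idP/idP; rewrite inE.
    rewrite (_ : (z \in _) = (r <= sqmod z)); last by apply/idP/idP; rewrite inE.
    by rewrite mem_setE in_itv/= andbT -mulnb natrM; ring.
  have K0 : 0 <= C * \1_[set z : V | r <= sqmod z] z by exact: mulr_ge0.
  rewrite (ge0_integralZl_EFin _ _ _ _ K0)//; last 2 first.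
  - by move=> t _; rewrite lee_fin; exact: mulr_ge0.
  - by apply/measurable_EFinP; exact: measurable_1e.
  rewrite integral_exponential_pdf_gt ?sqmod_ge0// -EFinM patchE indicE.
  by case: ifP => _; rewrite ?mulr1 ?mulr0 ?mul0r.
rewrite (fubini_tonelli (EFin \o Phi))//.
apply: eq_integral => t _.
transitivity (\int[mu2]_z ((C * e t)%:E *
    (\1_[set z : V | r <= sqmod z < t] z)%:E))%E.
  by apply: eq_integral => z _; rewrite -EFinM mulrC.
have K0 : 0 <= C * e t by exact: mulr_ge0.
rewrite (ge0_integralZl_EFin _ _ _ _ K0)//; last first.
  by apply/measurable_EFinP/measurable_indic; exact: measurable_annulus.
rewrite integral_indic ?setIT; [|exact: measurableT|exact: measurable_annulus].
by rewrite [X in (_ * X)%E]lebesgue_measure2_annulus// -EFinM.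
Qed.

(** Translating the level by [r] turns [psi r] into a constant multiple of [psi 0], whose integral
    is the probability of the whole plane. *)
Lemma complex_normal_tail r : 0 <= r ->
  cn [set z | r <= sqmod z] = (expR (- r / alpha))%:E.
Proof.
move=> r0; rewrite tail_psi//.
transitivity ((expR (- r / alpha))%:E * \int[mu]_t (psi 0 t)%:E)%E; last first.
  rewrite -tail_psi// (_ : [set _ | _] = setT) ?probability_setT ?mule1//.
  by apply/seteqP; split=> z //= _; exact: sqmod_ge0.
have mpsi r' : measurable_fun setT (psi r').
  apply: measurable_funM; first exact: measurable_funM.
  apply: measurable_funM => //; apply: measurable_maxr => //.
  exact: measurable_funB.
have psi0 r' t : (0 <= (psi r' t)%:E)%E.
  rewrite lee_fin; apply: mulr_ge0; first exact: mulr_ge0.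
  by apply: mulr_ge0; [exact: disc_area_ge0|rewrite le_max lexx].
rewrite -ge0_integralZl_EFin ?expR_ge0//; last first.
  by apply/measurable_EFinP; exact: mpsi.
rewrite (integral_affine r (ltr01 : 0 < 1 :> R)
  (f := fun t => (psi r t)%:E)) ?mul1e//; last first.
  by apply/measurable_EFinP; exact: mpsi.
apply: eq_integral => s _; rewrite mul1r -EFinM; congr EFin.
(* For s <= 0 both annuli are empty, so memorylessness is applied only where it holds. *)
rewrite /psi subr0 addrK; have [s0|s0] := leP s 0; first by rewrite !mulr0.
by rewrite (eD r0 (ltW s0)); ring.
Qed.
End tail.

(** * Linear combinations of independent complex normal entries *)

Definition image_probability d d' (T1 : measurableType d) (T2 : measurableType d')
    (R : realType) (P : probability T1 R) (f : T1 -> T2)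
    (mf : measurable_fun setT f) : probability T2 R :=
  distribution P
    (HB.pack_for {mfun T1 >-> T2} f (isMeasurableFun.Build _ _ _ _ f mf)).

Section linear_combination.
Context (R : realType) (alpha : R).
Hypothesis alpha0 : 0 < alpha.
Local Notation V := (measurableTypeR R * measurableTypeR R)%type.
Local Notation cn := (complex_normal alpha).

(** Factoring out c gives c (Z + (w/c) Y), which has the law of c s Z with s^2 = 1 + |w/c|^2. *)
Lemma complex_normal_combination (c w : V) : exists2 c' : V,
  sqmod c' = sqmod c + sqmod w &
  forall B : set V, measurable B ->
    (cn \x cn)%E [set zy | B (cmul c zy.1 + cmul w zy.2)] =
    cn [set z | B (cmul c' z)].
Proof.
(* Division by c is impossible when c = 0, but then only w Y remains. *)
have [c0|c0] := eqVneq (sqmod c) 0.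
  exists w => [|B mB]; first by rewrite c0 add0r.
  have /eqP -> : c == (0, 0) by rewrite -sqmod_eq0 c0.
  rewrite (_ : [set zy | _] = setT `*` [set y | B (cmul w y)]); last first.
    apply/seteqP; split=> -[z y] /=; rewrite /cmul/= !mul0r subrr addr0;
      by rewrite (_ : (0, 0) + _ =
          (w.1 * y.1 - w.2 * y.2, w.1 * y.2 + w.2 * y.1) :> V);
        [tauto|congr pair; rewrite /= add0r].
  rewrite product_measure1E//; last first.
    by rewrite -[X in measurable X]setTI; exact: measurable_cmul.
  by rewrite [X in (X * _)%E](_ : _ = 1%E) ?mul1e//; exact: probability_setT.
(* This is the complex quotient w/c, written as w conj(c)/|c|^2. *)
pose b : V := ((w.1 * c.1 + w.2 * c.2) / sqmod c,
  (w.2 * c.1 - w.1 * c.2) / sqmod c).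
pose s := Num.sqrt (1 + sqmod b).
have sE : s ^+ 2 = 1 + sqmod b by rewrite sqr_sqrtr// addr_ge0// sqmod_ge0.
have wE : cmul c b = w.
  move: c0; rewrite /b /cmul /sqmod [RHS]surjective_pairing => c0.
  by rewrite /=; congr pair; field.
exists (s * c.1, s * c.2) => [|B mB].
  by rewrite -wE sqmodM -[X in X + _]mulr1 -mulrDr -sE /sqmod/=; ring.
have mcB : measurable (cmul c @^-1` B).
  by rewrite -[X in measurable X]setTI; exact: measurable_cmul.
have := complex_normal_conv alpha0 b mcB.
rewrite -/s => cnE.
transitivity ((cn \x cn)%E
    [set zy | (cmul c @^-1` B) (affine2 1 (cmul b zy.2) zy.1)]).
  congr ((cn \x cn)%E _); apply/funext => -[z y] /=; congr B.
  by rewrite -wE; case: z y => [z1 z2] [y1 y2]; congr pair;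
    rewrite /cmul/affine2/=; ring.
rewrite cnE; congr (cn _); apply/funext => z /=; congr B.
by congr pair; rewrite /cmul/affine2/=; ring.
Qed.

Context d (T : measurableType d) (P : probability T R) (M : nat).
Variables (X : 'I_M -> T -> V) (w : 'I_M -> V).
Hypothesis mX : forall i, measurable_fun setT (X i).
Hypothesis lawX : forall i (B : set V), measurable B -> P (X i @^-1` B) = cn B.
Hypothesis indX : mutually_independent P X.

Let S k t : V := \sum_(i < M | (i < k)%N) cmul (w i) (X i t).

Let S0 t : S 0 t = 0. Proof. by rewrite /S big_pred0. Qed.

Let SS (j : 'I_M) t : S j.+1 t = S j t + cmul (w j) (X j t).
Proof.
rewrite /S (bigD1 j)//= addrC; congr (_ + _); apply: eq_bigl => i.
by rewrite ltnS -val_eqE /= ltn_neqAle andbC.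
Qed.

Let mS k : (k <= M)%N -> measurable_fun setT (S k).
Proof.
elim: k => [_|k IH kM].
  rewrite (_ : S 0 = cst 0); first exact: measurable_cst.
  by apply/funext => t; rewrite S0.
pose j := Ordinal kM.
rewrite (_ : S k.+1 = fun t => cmul (1, 0) (S k t) + cmul (w j) (X j t)).
  by apply: measurable_cmul_add => //; apply: IH; exact: ltnW.
apply/funext => t; rewrite (SS j) /=; congr (_ + _).
by case: (S k t) => s1 s2; rewrite /cmul/= !mul1r !mul0r subr0 addr0.
Qed.

Let mtail k (A : 'I_M -> set V) : (forall i, measurable (A i)) ->
  measurable [set t | forall i : 'I_M, (k <= i)%N -> A i (X i t)].
Proof.
move=> mA.
rewrite (_ : [set t | _] =
    \bigcap_(i in [set i : 'I_M | (k <= i)%N]) (X i @^-1` A i)) //.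
apply: fin_bigcap_measurable => [|i _]; first exact: finite_finset.
by rewrite -[X in measurable X]setTI; exact: mX.
Qed.

Let prod_ge0 k (A : 'I_M -> set V) :
  (0 <= \prod_(i < M | (k <= i)%N) cn (A i))%E.
Proof. by apply: (big_ind (fun x => 0 <= x)%E) => // x y; exact: mule_ge0. Qed.

Let prod_fin k (A : 'I_M -> set V) : (forall i, measurable (A i)) ->
  (\prod_(i < M | (k <= i)%N) cn (A i) \is a fin_num)%E.
Proof.
move=> mA; apply: (big_ind (fun x => x \is a fin_num)%E) => //.
  by move=> x y; exact: fin_numM.
by move=> i _; exact: fin_num_measure.
Qed.

(* Keeping the entries from k on in the event makes the product rule usable at
   each step without a lemma on independence of blocks.  The law is stated
   through a multiplier c, because [normal_prob] at standard deviation 0 is a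
   uniform law instead of a Dirac mass. *)
Lemma law_partial_sum k : (k <= M)%N -> exists2 c : V,
  sqmod c = \sum_(i < M | (i < k)%N) sqmod (w i) &
  forall (B : set V) (A : 'I_M -> set V),
  measurable B -> (forall i, measurable (A i)) ->
  P [set t | B (S k t) /\ forall i : 'I_M, (k <= i)%N -> A i (X i t)] =
  (cn [set z | B (cmul c z)] * \prod_(i < M | (k <= i)%N) cn (A i))%E.
Proof.
elim: k => [_|k IH kM].
  exists 0 => [|B A mB mA].
    by rewrite big_pred0// /sqmod/= expr0n addr0.
  rewrite (_ : [set z | B (cmul 0 z)] = [set _ | B 0]); last first.
    apply/funext => z; rewrite /= (_ : cmul 0 z = 0)//.
    by rewrite /cmul/= !mul0r subr0 addr0.
  (* The empty sum is 0, so the condition on [B] is sure or impossible; in the sure case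
     independence gives the product. *)
  have [B0|B0] := pselect (B 0).
    rewrite (_ : [set _ | B 0] = setT); last by apply/seteqP; split.
    rewrite [X in (X * _)%E](_ : _ = 1%E) ?mul1e; last exact: probability_setT.
    transitivity (P [set t | forall i, A i (X i t)]).
      congr (P _); apply/funext => t; apply/propext; rewrite /= S0.
      by split=> [[_ h] i|h]; [exact: h|split].
    by rewrite indX//; apply: eq_bigr => i _; rewrite lawX.
  rewrite (_ : [set _ | B 0] = set0); last by apply/seteqP; split.
  rewrite measure0 mul0e (_ : [set t | _] = set0) ?measure0//.
  by apply/seteqP; split=> t //= []; rewrite S0.
have [c cE lawS] := IH (ltnW kM).
pose j := Ordinal kM.
have [c' c'E law2] := complex_normal_combination c (w j).
exists c' => [|B A mB mA].
  rewrite c'E cE [RHS](bigD1 j)//= addrC; congr (_ + _); apply: eq_bigl => i.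
  by rewrite ltnS -val_eqE /= ltn_neqAle andbC.
set K := (\prod_(i < M | (k < i)%N) cn (A i))%E.
have K0 : 0 <= fine K by apply: fine_ge0; exact: prod_ge0.
have KE : K = (fine K)%:E by rewrite fineK//; exact: prod_fin.
pose D := [set t | forall i : 'I_M, (k.+1 <= i)%N -> A i (X i t)].
have mD : measurable D by exact: mtail.
pose Y t := (S k t, X j t).
have mY : measurable_fun setT Y.
  by apply: measurable_fun_pair; [exact: mS (ltnW kM)|exact: mX].
(* [m1] is the law of c Z weighted by [K], the product of the probabilities for the entries after
   [j]. *)
pose m1 := mscale (NngNum K0) (image_probability cn (measurable_cmul c)).
have m1E B' : m1 B' = (K * cn (cmul c @^-1` B'))%E by rewrite [in RHS]KE.
(* [m'] is the joint law of the partial sum and entry [j], restricted to the event [D] on later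
   entries. *)
pose m' := image_measure (mrestr P mD) mY.
pose E := [set xy : V * V | B (xy.1 + cmul (w j) xy.2)].
have mE : measurable E.
  have := @measurable_cmul_add R _ (V * V)%type (1, 0) (w j) fst snd
    measurable_fst measurable_snd.
  move=> /(_ measurableT B mB); rewrite setTI.
  congr (measurable _); apply/funext => -[[x1 x2] y] /=; congr B.
  by congr (_ + _); rewrite /cmul/= !mul1r !mul0r subr0 addr0.
have prodE : (m1 \x cn)%E E = m' E.
  apply: product_measure_unique => // B1 B2 mB1 mB2.
  (* With [B2] in slot [j], the induction hypothesis evaluates [m'] on the rectangle. *)
  pose A' i := if i == j then B2 else A i.
  have mA' i : measurable (A' i) by rewrite /A'; case: ifP.
  transitivity (P [set t | B1 (S k t) /\
      forall i : 'I_M, (k <= i)%N -> A' i (X i t)]).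
    rewrite /m' /= /pushforward /mrestr; congr (P _).
    apply/seteqP; split=> t /=.
      move=> [[B1S B2X] At]; split=> // i; rewrite leq_eqVlt => /orP[/eqP ki|ki].
        by rewrite /A' (_ : i = j) ?eqxx//; exact/val_inj.
      by rewrite /A' ifF; [exact: At|apply/eqP => ij; rewrite ij ltnn in ki].
    move=> [B1S At]; split; first split=> //.
      by have := At j (leqnn k); rewrite /A' eqxx.
    move=> i ki; have := At i (ltnW ki); rewrite /A' ifF//.
    by apply/eqP => ij; rewrite ij ltnn in ki.
  rewrite lawS// (bigD1 j)//= {1}/A' eqxx.
  rewrite (_ : (\prod_(i < M | _) _)%E = K); last first.
    apply: eq_big => [i|i /andP[_ /negbTE ij]]; last by rewrite /A' ij.
    by rewrite ltn_neqAle -val_eqE /= eq_sym andbC.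
  rewrite [X in _ = (X * _)%E](_ : _ = (K * cn (cmul c @^-1` B1))%E);
    last exact: m1E.
  by rewrite (muleC K) -muleA (muleC K).
transitivity (m' E).
  rewrite /m' /= /pushforward /mrestr; congr (P _); apply/funext => t.
  by rewrite /= (SS j).
rewrite -prodE -law2// KE muleC.
(* As an integral of sections, the product with [m1] is [K] times the product of two copies of [cn],
   pulled back along z -> c z. *)
rewrite /product_measure1.
apply: (ge0_integral_scaled_image (measurable_cmul c)) => //.
exact: measurable_fun_xsection.
Qed.
End linear_combination.

(** * From complex vectors to pairs of reals, and outage as a disc event *)

Section re_im.
Context (R : realType).
Implicit Types z w : R[i].

Lemma re_imM z w : re_im (z * w) = cmul (re_im z) (re_im w).
Proof. by case: z w => [a b] [c d]. Qed.

Lemma re_im_sum (I : finType) (F : I -> R[i]) :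
  re_im (\sum_i F i) = \sum_i re_im (F i).
Proof. by apply: (big_morph (@re_im R)) => // -[a b] [c d]. Qed.

Lemma sqmod_re_im z : sqmod (re_im z) = Normc.normc z ^+ 2.
Proof. by case: z => a b; rewrite sqr_sqrtr// addr_ge0 ?sqr_ge0. Qed.

Lemma sqmod_re_imJ z : sqmod (re_im (z^*)) = sqmod (re_im z).
Proof. by case: z => a b; rewrite /sqmod/re_im/= sqrrN. Qed.

Lemma re_im_hdot (M : nat) (w h : 'cV[R[i]]_M) :
  re_im (hdot w h) = \sum_i cmul (re_im ((w i ord0)^*)) (re_im (h i ord0)).
Proof.
by rewrite /hdot mxE re_im_sum; apply: eq_bigr => i _; rewrite !mxE re_imM.
Qed.

Lemma sum_sqmod_normalize (M : nat) (v : 'cV[R[i]]_M) : v != 0 ->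
  \sum_i sqmod (re_im (normalize v i ord0)) = 1.
Proof.
move=> v0; pose s := \sum_i sqmod (re_im (v i ord0)).
have s0 : s != 0.
  apply: contra v0; rewrite psumr_eq0 => [/allP sv|i _]; last exact: sqmod_ge0.
  apply/eqP/matrixP => i j; rewrite mxE (ord1 j).
  have := sv i (mem_index_enum _); rewrite sqmod_re_im sqrf_eq0 => /eqP.
  exact: Normc.eq0_normc.
have sE : l2norm v ^+ 2 = s.
  rewrite sqr_sqrtr; first by apply: eq_bigr => i _; rewrite sqmod_re_im.
  by apply: sumr_ge0 => i _; exact: sqr_ge0.
rewrite -(mulVf s0) mulr_sumr; apply: eq_bigr => i _.
rewrite mxE re_imM sqmodM -sE; congr (_ * _).
by rewrite /sqmod/= expr0n addr0 exprVn.
Qed.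

(** The logarithm is increasing, so a rate below target means that w^H h falls in a disc. *)
Lemma rate_lt (M : nat) (w h : 'cV[R[i]]_M) (p R0 : R) : 0 < p ->
  (rate p w h < R0) = (sqmod (re_im (hdot w h)) < (2 `^ R0 - 1) / p).
Proof.
move=> p0; have ln2_gt0 : 0 < ln 2 :> R by rewrite ln_gt0// ltr1n.
rewrite sqmod_re_im /rate /log2 ltr_pdivrMr// -ln_powR ltr_ln ?posrE ?powR_gt0//.
  by rewrite ltr_pdivlMr// ltrBrDl [_ * p]mulrC.
by rewrite ltr_pwDl// mulr_ge0 ?sqr_ge0// ltW.
Qed.
End re_im.

(** * The outage probability and its high-power limit *)

Lemma expR_ratio_bounds (R : realType) (x : R) : 0 < x ->
  1 - x <= (1 - expR (- x)) / x <= 1.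
Proof.
move=> x0; rewrite ler_pdivlMr// ler_pdivrMr// mul1r; apply/andP; split; last first.
  by have := expR_ge1Dx (- x); lra.
have : expR (- x) <= (1 + x)^-1.
  by rewrite expRN lef_pV2 ?posrE ?expR_gt0 ?expR_ge1Dx// addr_gt0.
move=> h; apply: (@le_trans _ _ (1 - (1 + x)^-1)); last by lra.
(* Inverting 1 + x <= exp(x) has reduced the lower bound to a rational inequality whose gap is
   x^3/(1 + x). *)
rewrite -subr_ge0 (_ : _ - _ = x ^+ 3 / (1 + x)).
  by rewrite divr_ge0 ?exprn_ge0 ?addr_ge0 ?ltW.
by field; rewrite gt_eqF// addr_gt0.
Qed.

Theorem theorem6 (R : realType) (d : measure_display) (T : measurableType d)
    (P : probability T R) (M : nat) (alpha R0 : R) (hs : 'cV[R[i]]_M)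
    (hc : T -> 'cV[R[i]]_M)
    (HM : (1 <= M)%N) (Halpha : 0 < alpha) (HR0 : 0 < R0) (Hhs : hs != 0)
    (Hhc : complex_normal_vector P alpha hc) :
  (forall p : R, 0 < p ->
     outage P R0 p (normalize hs) hc
       = (1 - expR (- ((2 `^ R0 - 1) / (p * alpha))))%:E) /\
  ratio_equiv_pinfty
    (fun p : R => fine (outage P R0 p (normalize hs) hc))
    (fun p : R => (2 `^ R0 - 1) / (p * alpha)).
Proof.
have c0 : 0 < 2 `^ R0 - 1.
  rewrite subr_gt0 -ltr_ln ?posrE ?powR_gt0// ln1 ln_powR.
  by rewrite mulr_gt0// ln_gt0// ltr1n.
have outageE p : 0 < p -> outage P R0 p (normalize hs) hc =
    (1 - expR (- ((2 `^ R0 - 1) / (p * alpha))))%:E.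
  move=> p0; have [mX lawX indX] := Hhc.
  (* The weights carry the conjugates of w^H h; at [k = M] the partial sum is complete and no later
     entry is constrained. *)
  pose w i := re_im ((normalize hs i ord0)^*).
  have [c cE lawS] := law_partial_sum Halpha w mX lawX indX (leqnn M).
  have c1 : sqmod c = 1.
    rewrite cE -(sum_sqmod_normalize Hhs).
    by apply: eq_big => [i|i _]; [rewrite ltn_ord|exact: sqmod_re_imJ].
  set r := (2 `^ R0 - 1) / p.
  have mr : measurable [set z | sqmod z < r :> R] by exact: measurable_disc.
  rewrite /outage.
  transitivity (P [set t | sqmod (\sum_(i < M | (i < M)%N)
      cmul (w i) (re_im (hc t i ord0))) < r /\
      forall i : 'I_M, (M <= i)%N -> setT (re_im (hc t i ord0))]).
    congr (P _); apply/funext => t; apply/propext => /=.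
    rewrite rate_lt// re_im_hdot -/r.
    under [in X in _ <-> X]eq_bigl do rewrite ltn_ord.
    by split=> [|[]].
  have := lawS [set z | sqmod z < r] (fun=> setT) mr (fun=> measurableT).
  move=> /= ->; rewrite big_pred0 ?mule1; last by move=> i; rewrite leqNgt ltn_ord.
  (* As |c| = 1, multiplication by [c] preserves the disc, whose complement is the tail event. *)
  have -> : [set z | sqmod (cmul c z) < r] = ~` [set z | r <= sqmod z].
    by apply/seteqP; split=> z /=; rewrite sqmodM c1 mul1r ltNge => /negP.
  rewrite [LHS]probability_setC; last exact: measurable_disc_ge.
  rewrite [X in (_ - X)%E]complex_normal_tail//; last by rewrite divr_ge0// ltW.
  rewrite -EFinB; congr (1 - expR _)%:E.
  by rewrite /r mulNr; congr (- _); rewrite invfM mulrA.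
split=> //; apply/cvgrPdist_le => e e0; near=> p.
have p0 : 0 < p by near: p; exact: nbhs_pinfty_gt.
rewrite outageE//=.
set x := (X in 1 - _ / X).
have x0 : 0 < x by rewrite divr_gt0// mulr_gt0.
have /andP[lo hi] := expR_ratio_bounds x0.
(* The ratio is within [x] of 1, and [x <= e] as soon as p >= (2^R0 - 1)/(e alpha). *)
rewrite ger0_norm ?subr_ge0//; apply: (@le_trans _ _ x); first by lra.
have : (2 `^ R0 - 1) / (e * alpha) <= p by near: p; apply: nbhs_pinfty_ge; exact: num_real.
rewrite /x !ler_pdivrMr ?mulr_gt0// => h; apply: le_trans h _.
by rewrite mulrCA mulrA.
Unshelve. all: end_near.
Qed.
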